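(* Let $G$ be a left orderable group, and let $P, Q \in LO(G)$ be given. Then $Q \in \overline{Orb_G(P)}$ if and only if $\ker(\pi_P) \subset \ker(\pi_Q)$, where $\pi_P : F(G) \to Aut(G,<_P)$ and $\pi_Q : F(G) \to Aut(G,<_Q)$ are the projections from the free lattice ordered group $F(G)$.
   Context: A group $G$ is left orderable if it admits a strict total ordering $<$ with $g<h \Rightarrow fg<fh$ for all $f,g,h\in G$. $LO(G)$ is the set of all positive cones of $G$, i.e. subsets $P \subset G$ with $P\cdot P \subset P$ and $P \sqcup P^{-1} \sqcup \{1\} = G$ (disjoint union). Each $P \in LO(G)$ determines a left ordering $<_P$ by $g <_P h \iff g^{-1}h \in P$. $LO(G)$ carries the topology with subbasis the sets $U_g = \{P \in LO(G) : g \in P\}$, $g \in G$. $G$ acts on $LO(G)$ by conjugation, $Orb_G(P) = \{gPg^{-1} : g \in G\}$, and $\overline{Orb_G(P)}$ is its closure in $LO(G)$. For $P \in LO(G)$, $Aut(G,<_P)$ is the group of order-preserving bijections of the totally ordered set $(G,<_P)$; it is a lattice-ordered group whose lattice operations are pointwise: $(f\vee g)(x)=\max\{f(x),g(x)\}$, $(f\wedge g)(x)=\min\{f(x),g(x)\}$ with respect to $<_P$. For $g\in G$ let $g_P \in Aut(G,<_P)$ be left multiplication, $g_P(h)=gh$. Let $i: G \to \prod_{P \in LO(G)} Aut(G,<_P)$ be $g \mapsto (g_P)_P$, the product having componentwise group and lattice operations. The free lattice ordered group $F(G)$ is the smallest subset of this product containing $i(G)$ and closed under the group and lattice operations, and $\pi_P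 : F(G) \to Aut(G,<_P)$ is the restriction of the projection to the $P$-th factor. *)

(* Defs.v *)
From HB Require Import structures.
From mathcomp Require Export all_boot all_order.
From mathcomp Require Export boolp classical_sets functions topology.

Set Implicit Arguments.
Unset Strict Implicit.
Unset Printing Implicit Defensive.

Import Order.TTheory.
Local Open Scope classical_set_scope.
Local Open Scope group_scope.

Record left_order (G : groupType) (lt : G -> G -> Prop) : Prop := LeftOrder {
  left_order_irr : forall g, ~ lt g g;
  left_order_trans : forall g h k, lt g h -> lt h k -> lt g k;
  left_order_total : forall g h, [\/ lt g h, g = h | lt h g];
  left_order_mul : forall f g h, lt g h -> lt (f * g) (f * h)
}.

Definition left_orderable (G : groupType) :=
  exists lt : G -> G -> Prop, left_order lt.

Definition cone_inv (G : groupType) (P : set G) : set G := [set g^-1 | g in P].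

(* The last four fields say that G is the disjoint union of P, P^-1, {1}. *)
Record positive_cone (G : groupType) (P : set G) : Prop := PositiveCone {
  pcone_mul : [set g * h | g in P & h in P] `<=` P;
  pcone_cover : P `|` cone_inv P `|` [set 1] = setT;
  pcone_disjV : P `&` cone_inv P = set0;
  pcone_disj1 : P `&` [set 1] = set0;
  pcone_disjV1 : cone_inv P `&` [set 1] = set0
}.

Record LO (G : groupType) : Type := MkLO {
  cone :> set G;
  coneP : positive_cone cone
}.

Section ConeTheory.
Variable G : groupType.
Implicit Types (P : LO G) (g h : G).

Lemma LO_eq (P Q : LO G) : cone P = cone Q -> P = Q.
Proof.
case: P Q => [P cP] [Q cQ] /= eqPQ; move: cQ; rewrite -eqPQ => cQ.
by congr MkLO; exact: Prop_irrelevance.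
Qed.

Lemma coneM P g h : cone P g -> cone P h -> cone P (g * h).
Proof. by move=> Pg Ph; apply: (pcone_mul (coneP P)); exists g => //; exists h. Qed.

Lemma cone1 P : ~ cone P 1.
Proof. by move=> P1; have : (P `&` [set 1]) 1 by []; rewrite (pcone_disj1 (coneP P)). Qed.

Lemma coneVP P g : cone_inv P g <-> cone P g^-1.
Proof.
by split=> [[h Ph <-]|Pg]; [rewrite invgK|exists g^-1; rewrite ?invgK].
Qed.

Lemma coneV P g : cone P g -> ~ cone P g^-1.
Proof.
move=> Pg /coneVP Pg'; have : (P `&` cone_inv P) g by [].
by rewrite (pcone_disjV (coneP P)).
Qed.

Lemma cone_total P g : [\/ cone P g, cone P g^-1 | g = 1].
Proof.
have : (P `|` cone_inv P `|` [set 1]) g by rewrite (pcone_cover (coneP P)).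
by move=> [[Pg|/coneVP Pg]|->]; [constructor 1|constructor 2|constructor 3].
Qed.

Lemma positive_coneP (P : set G) :
  (forall g h, P g -> P h -> P (g * h)) -> ~ P 1 ->
  (forall g, [\/ P g, P g^-1 | g = 1]) -> positive_cone P.
Proof.
move=> PM P1 Ptot.
have VP g : cone_inv P g -> P g^-1 by case=> h Ph <-; rewrite invgK.
split.
- by move=> _ [g Pg [h Ph <-]]; exact: PM.
- rewrite -subTset => g _; case: (Ptot g) => [Pg|Pg|->]; [|  |by right].
    by left; left.
  by left; right; exists g^-1 => //; rewrite invgK.
- rewrite -subset0 => g [Pg /VP Pg']; apply: P1.
  by rewrite -(mulgV g); exact: PM.
- by rewrite -subset0 => g [Pg ge1]; apply: P1; rewrite -ge1.
- by rewrite -subset0 => g [/VP Pg ge1]; apply: P1; rewrite -invg1 -ge1.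
Qed.

End ConeTheory.

HB.instance Definition _ (G : groupType) := gen_eqMixin (LO G).
HB.instance Definition _ (G : groupType) := gen_choiceMixin (LO G).

Definition LO_sub (G : groupType) (g : G) : set (LO G) := [set P | cone P g].

(* The U_g form a subbasis: the index type is set (LO G) itself, since the
   factory wants a pointed index type, and the subbasic sets are the U_g. *)
HB.instance Definition _ (G : groupType) :=
  isSubBaseTopological.Build (LO G) (range (@LO_sub G)) id.

Definition conj_set (G : groupType) (g : G) (P : set G) : set G :=
  [set g * p * g^-1 | p in P].

Fact conj_set_cone (G : groupType) (g : G) (P : LO G) :
  positive_cone (conj_set g P).
Proof.
apply: positive_coneP.
- move=> _ _ [x Px <-] [y Py <-]; exists (x * y); first exact: coneM.
  by rewrite !mulgA mulgVK.
- move=> [x Px] /(congr1 (fun z => g^-1 * z * g)).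
  by rewrite mulg1 mulVg !mulgA mulVg mul1g mulgVK => x1; apply: (@cone1 _ P); rewrite -x1.
- move=> x; case: (cone_total P (g^-1 * x * g)) => Px.
  + by constructor 1; exists (g^-1 * x * g); rewrite // !mulgA mulgK mulgV mul1g.
  + constructor 2; exists (g^-1 * x * g)^-1 => //.
    by rewrite !invgM invgK !mulgA mulgV mul1g mulgK.
  + constructor 3; apply: (mulIg g); apply: (mulgI g^-1).
    by rewrite mul1g mulVg mulgA.
Qed.

Definition conj_LO (G : groupType) (g : G) (P : LO G) : LO G :=
  MkLO (conj_set_cone g P).

Definition Orb (G : groupType) (P : LO G) : set (LO G) :=
  [set conj_LO g P | g in setT].

Fact cone_display : Order.disp_t. Proof. exact: Order.Disp tt tt. Qed.

(* An alias of G, so that each P can carry its own canonical order <_P. *)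
Definition ordG (G : groupType) (P : LO G) : Type := G.

HB.instance Definition _ (G : groupType) (P : LO G) := Choice.on (ordG P).

Definition cone_lt (G : groupType) (P : LO G) : rel (ordG P) :=
  fun g h => `[< cone P ((g : G)^-1 * (h : G)) >].
Definition cone_le (G : groupType) (P : LO G) : rel (ordG P) :=
  fun g h => (g == h) || cone_lt g h.

Section ConeOrder.
Variables (G : groupType) (P : LO G).

Fact cone_lt_irr : irreflexive (@cone_lt G P).
Proof. by move=> g; apply/asboolPn; rewrite mulVg; exact: cone1. Qed.

Fact cone_lt_trans : transitive (@cone_lt G P).
Proof.
move=> h g k /asboolP gh /asboolP hk; apply/asboolP.
by have := coneM gh hk; rewrite mulgA mulgK.
Qed.

Fact cone_lt_total (g h : ordG P) : g != h -> cone_lt g h || cone_lt h g.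
Proof.
move=> /eqP gh; apply/orP.
case: (cone_total P ((g : G)^-1 * (h : G))) => H.
- by left; apply/asboolP.
- by right; apply/asboolP; rewrite invgM invgK in H.
- by case: gh; apply: (mulgI (g : G)^-1); rewrite H mulVg.
Qed.

HB.instance Definition _ := Order.LtOrder.Build cone_display (ordG P)
  (fun g h => erefl) (fun g h => erefl) (fun g h => erefl)
  cone_lt_irr cone_lt_trans cone_lt_total.

End ConeOrder.

(* On a total order, strictly increasing bijections have increasing inverses. *)
Record aut d (T : orderType d) : Type := MkAut {
  aut_fun :> T -> T;
  aut_bij : bijective aut_fun;
  aut_homo : {homo aut_fun : x y / (x < y)%O}
}.

HB.instance Definition _ d (T : orderType d) := gen_eqMixin (aut T).
HB.instance Definition _ d (T : orderType d) := gen_choiceMixin (aut T).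

Section Aut.
Variables (d : Order.disp_t) (T : orderType d).
Implicit Types f g h : aut T.

Lemma aut_eq f g : f =1 g -> f = g.
Proof.
case: f g => [f bf hf] [g bg hg] /= /funext eqfg.
by move: bg hg; rewrite -eqfg => bg hg; congr MkAut; exact: Prop_irrelevance.
Qed.

Lemma aut_le f x y : (f x <= f y)%O = (x <= y)%O.
Proof. exact: (le_mono (@aut_homo _ _ f)). Qed.

Lemma aut_lt f x y : (f x < f y)%O = (x < y)%O.
Proof. exact: (leW_mono (aut_le f)). Qed.

Fact aut1_bij : bijective (id : T -> T). Proof. by exists id. Qed.
Definition aut1 : aut T := MkAut aut1_bij (fun x y lt_xy => lt_xy).

Fact autM_homo f g : {homo f \o g : x y / (x < y)%O}.
Proof. by move=> x y lt_xy /=; rewrite !aut_lt. Qed.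
Definition autM f g : aut T :=
  MkAut (bij_comp (aut_bij f) (aut_bij g)) (@autM_homo f g).

Fact aut_inv_ex f : exists f' : T -> T, cancel f f' /\ cancel f' f.
Proof. by case: (aut_bij f) => f' ff' f'f; exists f'. Qed.
Definition aut_invfun f : T -> T := sval (cid (aut_inv_ex f)).
Lemma aut_funK f : cancel f (aut_invfun f).
Proof. exact: (svalP (cid (aut_inv_ex f))).1. Qed.
Lemma aut_invfunK f : cancel (aut_invfun f) f.
Proof. exact: (svalP (cid (aut_inv_ex f))).2. Qed.

Fact autV_bij f : bijective (aut_invfun f).
Proof. by exists f; [exact: aut_invfunK|exact: aut_funK]. Qed.
Fact autV_homo f : {homo aut_invfun f : x y / (x < y)%O}.
Proof. by move=> x y lt_xy; rewrite -(aut_lt f) !aut_invfunK. Qed.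
Definition autV f : aut T := MkAut (autV_bij f) (@autV_homo f).

Fact autMA : associative autM. Proof. by move=> f g h; exact: aut_eq. Qed.
Fact aut1M : left_id aut1 autM. Proof. by move=> f; exact: aut_eq. Qed.
Fact autM1 : right_id aut1 autM. Proof. by move=> f; exact: aut_eq. Qed.
Fact autVM : left_inverse aut1 autV autM.
Proof. by move=> f; apply: aut_eq => x /=; rewrite aut_funK. Qed.
Fact autMV : right_inverse aut1 autV autM.
Proof. by move=> f; apply: aut_eq => x /=; rewrite aut_invfunK. Qed.

HB.instance Definition _ :=
  isGroup.Build (aut T) autMA aut1M autM1 autVM autMV.

Definition join_fun f g : T -> T := fun x => Order.max (f x) (g x).
Definition meet_fun f g : T -> T := fun x => Order.min (f x) (g x).

Fact join_fun_homo f g : {homo join_fun f g : x y / (x < y)%O}.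
Proof. by move=> x y xy; rewrite /join_fun gt_max !lt_max !aut_lt xy orbT. Qed.

Fact meet_fun_homo f g : {homo meet_fun f g : x y / (x < y)%O}.
Proof. by move=> x y xy; rewrite /meet_fun lt_min !gt_min !aut_lt xy orbT. Qed.

Lemma join_meetK f g : cancel (join_fun f g) (meet_fun (autV f) (autV g)).
Proof.
move=> x; rewrite /join_fun /meet_fun /=.
case: (leP (f x) (g x)) => [le_fg|/ltW le_gf].
  by rewrite aut_funK; apply/min_idPr; rewrite -(aut_le f) aut_invfunK.
by rewrite aut_funK; apply/min_idPl; rewrite -(aut_le g) aut_invfunK.
Qed.

Lemma meet_joinK f g : cancel (meet_fun f g) (join_fun (autV f) (autV g)).
Proof.
move=> x; rewrite /join_fun /meet_fun /=.
case: (leP (f x) (g x)) => [le_fg|/ltW le_gf].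
  by rewrite aut_funK; apply/max_idPl; rewrite -(aut_le g) aut_invfunK.
by rewrite aut_funK; apply/max_idPr; rewrite -(aut_le f) aut_invfunK.
Qed.

Lemma autVK f : autV (autV f) = f.
Proof.
apply: aut_eq => x /=; apply: (bij_inj (autV_bij f)).
by rewrite aut_funK; exact: (aut_invfunK (autV f)).
Qed.

Fact join_fun_bij f g : bijective (join_fun f g).
Proof.
exists (meet_fun (autV f) (autV g)); first exact: join_meetK.
by have := meet_joinK (autV f) (autV g); rewrite !autVK.
Qed.

Fact meet_fun_bij f g : bijective (meet_fun f g).
Proof.
exists (join_fun (autV f) (autV g)); first exact: meet_joinK.
by have := join_meetK (autV f) (autV g); rewrite !autVK.
Qed.

Definition aut_join f g : aut T := MkAut (join_fun_bij f g) (@join_fun_homo f g).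
Definition aut_meet f g : aut T := MkAut (meet_fun_bij f g) (@meet_fun_homo f g).

Definition aut_leq : rel (aut T) := fun f g => `[< forall x, (f x <= g x)%O >].

Fact aut_leq_refl : reflexive aut_leq. Proof. by move=> f; apply/asboolP. Qed.
Fact aut_leq_anti : antisymmetric aut_leq.
Proof.
move=> f g /andP[/asboolP fg /asboolP gf]; apply: aut_eq => x.
by apply/le_anti; rewrite fg gf.
Qed.
Fact aut_leq_trans : transitive aut_leq.
Proof.
move=> g f h /asboolP fg /asboolP gh; apply/asboolP => x.
exact: le_trans (fg x) (gh x).
Qed.

HB.instance Definition _ := Order.Le_isPOrder.Build d (aut T)
  aut_leq_refl aut_leq_anti aut_leq_trans.

Fact aut_meetP f g h : (f <= aut_meet g h)%O = (f <= g)%O && (f <= h)%O.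
Proof.
apply/asboolP/andP => [H|[/asboolP fg /asboolP fh] x].
  by split; apply/asboolP => x; have := H x; rewrite le_min => /andP[].
by rewrite le_min fg fh.
Qed.
Fact aut_joinP f g h : (aut_join f g <= h)%O = (f <= h)%O && (g <= h)%O.
Proof.
apply/asboolP/andP => [H|[/asboolP fh /asboolP gh] x].
  by split; apply/asboolP => x; have := H x; rewrite ge_max => /andP[].
by rewrite ge_max fh gh.
Qed.

HB.instance Definition _ := Order.POrder_MeetJoin_isLattice.Build d (aut T)
  aut_meetP aut_joinP.

End Aut.

Section LeftMul.
Variables (G : groupType) (P : LO G).

Definition lmul_fun (g : G) : ordG P -> ordG P := fun h => g * (h : G).

Fact lmul_bij g : bijective (lmul_fun g).
Proof. by exists (lmul_fun g^-1); [exact: mulKg|exact: mulVKg]. Qed.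

Fact lmul_homo g : {homo lmul_fun g : x y / (x < y)%O}.
Proof.
by move=> x y /asboolP xy; apply/asboolP; rewrite invgM -mulgA mulKg.
Qed.

Definition lmul (g : G) : aut (ordG P) := MkAut (lmul_bij g) (@lmul_homo g).

End LeftMul.

Definition prodAut (G : groupType) : Type := forall P : LO G, aut (ordG P).

HB.instance Definition _ (G : groupType) := gen_eqMixin (prodAut G).
HB.instance Definition _ (G : groupType) := gen_choiceMixin (prodAut G).

Section ProdAut.
Variable G : groupType.
Implicit Types u v w : prodAut G.

Lemma prodAut_eq u v : (forall P, u P = v P) -> u = v.
Proof. by move=> uv; exact: functional_extensionality_dep. Qed.

Definition prodAut_one : prodAut G := fun P => 1.
Definition prodAut_mul u v : prodAut G := fun P => u P * v P.
Definition prodAut_inv u : prodAut G := fun P => (u P)^-1.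
Definition prodAut_join u v : prodAut G := fun P => (u P `|` v P)%O.
Definition prodAut_meet u v : prodAut G := fun P => (u P `&` v P)%O.

Fact prodAut_mulA : associative prodAut_mul.
Proof. by move=> u v w; apply: prodAut_eq => P; exact: mulgA. Qed.
Fact prodAut_mul1 : left_id prodAut_one prodAut_mul.
Proof. by move=> u; apply: prodAut_eq => P; exact: mul1g. Qed.
Fact prodAut_mulr1 : right_id prodAut_one prodAut_mul.
Proof. by move=> u; apply: prodAut_eq => P; exact: mulg1. Qed.
Fact prodAut_mulV : left_inverse prodAut_one prodAut_inv prodAut_mul.
Proof. by move=> u; apply: prodAut_eq => P; exact: mulVg. Qed.
Fact prodAut_mulrV : right_inverse prodAut_one prodAut_inv prodAut_mul.
Proof. by move=> u; apply: prodAut_eq => P; exact: mulgV. Qed.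

HB.instance Definition _ := isGroup.Build (prodAut G)
  prodAut_mulA prodAut_mul1 prodAut_mulr1 prodAut_mulV prodAut_mulrV.

Definition prodAut_leq : rel (prodAut G) :=
  fun u v => `[< forall P, (u P <= v P)%O >].

Fact prodAut_leq_refl : reflexive prodAut_leq.
Proof. by move=> u; apply/asboolP. Qed.
Fact prodAut_leq_anti : antisymmetric prodAut_leq.
Proof.
move=> u v /andP[/asboolP uv /asboolP vu]; apply: prodAut_eq => P.
by apply/le_anti; rewrite uv vu.
Qed.
Fact prodAut_leq_trans : transitive prodAut_leq.
Proof.
move=> v u w /asboolP uv /asboolP vw; apply/asboolP => P.
exact: le_trans (uv P) (vw P).
Qed.

HB.instance Definition _ := Order.Le_isPOrder.Build cone_display (prodAut G)
  prodAut_leq_refl prodAut_leq_anti prodAut_leq_trans.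

Fact prodAut_meetP u v w :
  (u <= prodAut_meet v w)%O = (u <= v)%O && (u <= w)%O.
Proof.
apply/asboolP/andP => [H|[/asboolP uv /asboolP uw] P].
  by split; apply/asboolP => P; have := H P; rewrite lexI => /andP[].
by rewrite lexI uv uw.
Qed.
Fact prodAut_joinP u v w :
  (prodAut_join u v <= w)%O = (u <= w)%O && (v <= w)%O.
Proof.
apply/asboolP/andP => [H|[/asboolP uw /asboolP vw] P].
  by split; apply/asboolP => P; have := H P; rewrite leUx => /andP[].
by rewrite leUx uw vw.
Qed.

HB.instance Definition _ := Order.POrder_MeetJoin_isLattice.Build
  cone_display (prodAut G) prodAut_meetP prodAut_joinP.

End ProdAut.

Definition embed (G : groupType) (g : G) : prodAut G := fun P => lmul P g.

Record lgroup_closed (G : groupType) (S : set (prodAut G)) : Prop :=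
  LGroupClosed {
  lgroup_closed1 : S 1;
  lgroup_closedM : forall u v, S u -> S v -> S (u * v);
  lgroup_closedV : forall u, S u -> S u^-1;
  lgroup_closedU : forall u v, S u -> S v -> S (u `|` v)%O;
  lgroup_closedI : forall u v, S u -> S v -> S (u `&` v)%O
}.

Definition free_lset (G : groupType) : set (prodAut G) :=
  smallest (@lgroup_closed G) (range (@embed G)).

Arguments free_lset G _ : clear implicits.

Definition freeL (G : groupType) : Type := set_type (free_lset G).

HB.instance Definition _ (G : groupType) := SubChoice.on (freeL G).

Section FreeL.
Variable G : groupType.

Lemma free_lset_closed : lgroup_closed (free_lset G).
Proof.
split=> [|u v Su Sv|u Su|u v Su Sv|u v Su Sv] A [cA sA].
- exact: lgroup_closed1 cA.
- by apply: (lgroup_closedM cA); [exact: Su|exact: Sv].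
- by apply: (lgroup_closedV cA); exact: Su.
- by apply: (lgroup_closedU cA); [exact: Su|exact: Sv].
- by apply: (lgroup_closedI cA); [exact: Su|exact: Sv].
Qed.

Fact free_lset_group : group_closed (mem (free_lset G)).
Proof.
have [S1 SM SV _ _] := free_lset_closed; split; first exact/mem_set.
move=> u v /set_mem Su /set_mem Sv; apply/mem_set; apply: SM; first exact: Su.
by apply: SV; exact: Sv.
Qed.

HB.instance Definition _ :=
  SubChoice_isSubGroup.Build (prodAut G) (mem (free_lset G)) (freeL G)
    free_lset_group.

End FreeL.

Definition proj (G : groupType) (P : LO G) (u : freeL G) : aut (ordG P) :=
  (val u : prodAut G) P.

Definition ker_proj (G : groupType) (P : LO G) : set (freeL G) :=
  [set u | proj P u = 1].

(* Main.v *)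
Require Import Defs.
From mathcomp Require Import finmap.

(** An element [u] of the free lattice-ordered group is a lattice-group word in
    left translations, so evaluating its [R]-component at [x] only multiplies
    by elements of the group and compares finitely many of them for [<_R].  Two
    facts follow by induction on the word.

    - [free_locally_constant]: near a given cone the value [u R x] does not
      depend on [R], because each comparison is decided by the membership of
      one group element in [R], and such a membership is an open condition.
    - [free_conj]: [u] commutes with conjugation of cones, because the right
      translation [x |-> x h^-1] is an order isomorphism from [<_R] to
      [<_(h R h^-1)] that commutes with left translations.

    If [pi_P u] is trivial, then so is [pi_R u] for every conjugate [R] of [P]
    by [free_conj], and hence, by [free_locally_constant], for every [Q] in the
    closure of the orbit.

    Conversely, a basic neighbourhood of [Q] consists of the cones containing
    some [g_1, ..., g_n] of [Q].  The element [(g_1 /\ ... /\ g_n) \/ 1] moves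
    the point [x] for [<_R] exactly when every [x^-1 g_i x] lies in [R], by
    [meet_embed_gt].  It moves [1] for [<_Q], so it lies outside [ker pi_Q] and
    thus outside [ker pi_P]: it moves some [x] for [<_P], which says that
    [x P x^-1] belongs to the neighbourhood. *)

Set Implicit Arguments.
Unset Strict Implicit.
Unset Printing Implicit Defensive.

Import Order.TTheory.
Local Open Scope classical_set_scope.
Local Open Scope group_scope.

Lemma nbhs_LO_sub (G : groupType) (g : G) (R : LO G) :
  cone R g -> nbhs R (LO_sub g).
Proof.
move=> Rg; apply: open_nbhs_nbhs; split=> //.
exists [set LO_sub g]; last by rewrite bigcup_set1.
by move=> _ ->; apply: (@finI_from1 _ _ _ id); exists g.
Qed.

Lemma nbhs_LOP (G : groupType) (R : LO G) (B : set (LO G)) : nbhs R B ->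
  exists2 s : seq G, {in s, forall g, cone R g} &
    forall S : LO G, {in s, forall g, cone S g} -> B S.
Proof.
rewrite nbhsE => -[_ [[D Dfin <-] [A DA AR]] DB].
have {AR} AR : (A : set (LO G)) R by [].
have {DB} AB : A `<=` B by move=> S AS; apply: DB; exists A.
have {D Dfin DA} [E sE AE] : finI_from (range (@LO_sub G)) id A := Dfin _ DA.
have genE (C : set (LO G)) : exists g, C \in E -> C = LO_sub g.
  have [/sE/set_mem[g _ <-]|nE] := boolP (C \in E); first by exists g.
  by exists 1 => CE; case/negP: nE.
have [gen gensP] := choice genE.
exists [seq gen C | C <- E] => [g /mapP[C CE ->]|S sS].
  move: AR; rewrite -AE => /(_ C CE) /=.
  by rewrite {1}(gensP C CE).
apply: AB; rewrite -AE => C CE /=.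
by rewrite (gensP C CE); apply/sS/map_f.
Qed.

Lemma freeL_ind (G : groupType) (S : set (prodAut G)) :
  lgroup_closed S -> (forall g, S (embed g)) -> forall u : freeL G, S (val u).
Proof.
move=> cS eS u; have := set_valP u; apply; split=> // _ [g _ <-]; exact: eS.
Qed.

Lemma conj_LOP (G : groupType) (h : G) (R : LO G) (g : G) :
  cone (conj_LO h R) g <-> cone R (h^-1 * g * h).
Proof.
split=> [[p Rp <-]|Rg]; first by rewrite !mulgA mulVg mul1g mulgVK.
by exists (h^-1 * g * h) => //; rewrite !mulgA mulgK mulgV mul1g.
Qed.

Lemma cone_ltE (G : groupType) (R : LO G) (x y : ordG R) :
  (x < y)%O = `[< cone R ((x : G)^-1 * (y : G)) >].
Proof. by []. Qed.

Lemma rmul_lt (G : groupType) (R : LO G) (h : G) (x y : G) :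
  ((x * h^-1 : ordG (conj_LO h R)) < y * h^-1)%O = ((x : ordG R) < y)%O.
Proof.
rewrite !cone_ltE; apply: asbool_equiv_eq.
by rewrite conj_LOP invgM invgK !mulgA mulVg mul1g mulgVK.
Qed.

Lemma prodAut_joinE (G : groupType) (u v : prodAut G) (R : LO G) (x : ordG R) :
  (u `|` v)%O R x = Order.max (u R x) (v R x).
Proof. by []. Qed.

Lemma prodAut_meetE (G : groupType) (u v : prodAut G) (R : LO G) (x : ordG R) :
  (u `&` v)%O R x = Order.min (u R x) (v R x).
Proof. by []. Qed.

(** Right translation by [h^-1] is an isomorphism from [<_R] to
    [<_(h R h^-1)] commuting with left translations, so words commute with it. *)
Lemma free_conj (G : groupType) (R : LO G) (h : G) (u : freeL G) (x : G) :
  (val u) (conj_LO h R) (x * h^-1) = ((val u) R x : G) * h^-1.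
Proof.
pose S : set (prodAut G) :=
  [set u | forall x : G, u (conj_LO h R) (x * h^-1) = (u R x : G) * h^-1].
suff: S (val u) by apply.
apply: freeL_ind => [|g y]; last exact: mulgA.
split=> [y //|v w Sv Sw y|v Sv y|v w Sv Sw y|v w Sv Sw y].
- by rewrite -[LHS]/(v _ (w _ _)) Sw Sv.
- apply: (bij_inj (aut_bij (v (conj_LO h R)))).
  by rewrite Sv -[LHS]/(v _ (aut_invfun _ _)) !aut_invfunK.
- rewrite !prodAut_joinE Sv Sw /Order.max rmul_lt.
  by case: ifP.
- rewrite !prodAut_meetE Sv Sw /Order.min rmul_lt.
  by case: ifP.
Qed.

(** For [x <> y], totality makes both [x < y] and its negation the membership
    of one group element in the cone, which is an open condition. *)
Lemma lt_locally_constant (G : groupType) (R : LO G) (x y : G) :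
  \forall R' \near R, ((x : ordG R') < y)%O = ((x : ordG R) < y)%O.
Proof.
case: (ltgtP (x : ordG R) y) => [xy|yx|->].
- have /asboolP Rxy := xy; near=> R'; apply/asboolP.
  by near: R'; exact: nbhs_LO_sub.
- have /asboolP Ryx := yx; near=> R'; apply: lt_gtF; apply/asboolP.
  by near: R'; exact: nbhs_LO_sub.
- by near=> R'; rewrite ltxx.
Unshelve. all: by end_near. Qed.

Lemma free_locally_constant (G : groupType) (R : LO G) (u : freeL G) (x : G) :
  \forall R' \near R, ((val u) R' x : G) = (val u) R x.
Proof.
pose S : set (prodAut G) :=
  [set u | forall x : G, \forall R' \near R, (u R' x : G) = u R x].
suff: S (val u) by apply.
apply: freeL_ind => [|g y]; last by near=> R'.
split=> [y|v w Sv Sw y|v Sv y|v w Sv Sw y|v w Sv Sw y].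
- by near=> R'.
- near=> R'; rewrite -[LHS]/(v R' (w R' y)).
  have -> : w R' y = w R y :> G by near: R'; exact: Sw.
  by near: R'; exact: (Sv (w R y)).
(* The hypothesis on [v] is used at the point that [v R] sends to [y]. *)
- near=> R'; apply: (bij_inj (aut_bij (v R'))).
  rewrite -[LHS]/(v R' (aut_invfun _ _)) aut_invfunK.
  have -> : v R' (v^-1 R y) = v R (v^-1 R y) :> G.
    by near: R'; exact: (Sv (v^-1 R y)).
  by rewrite -[RHS]/(v R (aut_invfun _ _)) aut_invfunK.
- near=> R'; rewrite !prodAut_joinE /Order.max.
  have -> : v R' y = v R y :> G by near: R'; exact: Sv.
  have -> : w R' y = w R y :> G by near: R'; exact: Sw.
  have -> : ((v R y : ordG R') < (w R y : G))%O = (v R y < w R y)%O.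
    by near: R'; exact: lt_locally_constant.
  by [].
- near=> R'; rewrite !prodAut_meetE /Order.min.
  have -> : v R' y = v R y :> G by near: R'; exact: Sv.
  have -> : w R' y = w R y :> G by near: R'; exact: Sw.
  have -> : ((v R y : ordG R') < (w R y : G))%O = (v R y < w R y)%O.
    by near: R'; exact: lt_locally_constant.
  by [].
Unshelve. all: by end_near. Qed.

Lemma free_lset_embed (G : groupType) (g : G) : free_lset G (embed g).
Proof. by move=> A [_]; apply; exists g. Qed.

(** The head is split off because an empty meet would be a top element, which a
    nontrivial lattice-ordered group lacks. *)
Definition meet_embed (G : groupType) (g : G) (s : seq G) : prodAut G :=
  foldr (fun h u => embed h `&` u)%O (embed g) s.

Lemma free_lset_meet_embed (G : groupType) (g : G) (s : seq G) :
  free_lset G (meet_embed g s).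
Proof.
elim: s => [|h s IH] /=; first exact: free_lset_embed.
by apply: (lgroup_closedI (@free_lset_closed G)) => //; exact: free_lset_embed.
Qed.

Lemma meet_embed_gt (G : groupType) (g : G) (s : seq G) (R : LO G) (x : G) :
  ((x : ordG R) < meet_embed g s R x)%O <->
  {in g :: s, forall h, cone (conj_LO x R) h}.
Proof.
have base h : ((x : ordG R) < embed h R x)%O <-> cone (conj_LO x R) h.
  rewrite conj_LOP cone_ltE -[embed h R x]/(h * x) mulgA.
  by split=> /asboolP.
elim: s => [|h s IH].
  rewrite base; split=> [Rg k|]; last by apply; exact: mem_head.
  by rewrite inE => /eqP ->.
rewrite -[meet_embed g (h :: s)]/(embed h `&` meet_embed g s)%O.
rewrite prodAut_meetE lt_min; split=> [/andP[/base Rh /IH Rs] k|Rs].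
  by rewrite !inE orbCA => /predU1P[->//|ks]; apply: Rs; rewrite inE.
apply/andP; split; first by apply/base/Rs; rewrite !inE eqxx orbT.
by apply/IH => k ks; apply: Rs; rewrite !inE orbCA -in_cons ks orbT.
Qed.

Lemma join1_fixE (G : groupType) (u : prodAut G) (R : LO G) (x : G) :
  ((u `|` 1)%O R x = x) <-> ~~ ((x : ordG R) < u R x)%O.
Proof.
rewrite prodAut_joinE -leNgt.
by split=> [/max_idPr|/max_idPr].
Qed.

Theorem theorem3p3 (G : groupType) (hG : left_orderable G) (P Q : LO G) :
  closure (Orb P) Q <-> ker_proj P `<=` ker_proj Q.
Proof.
split=> [clQ u uP|kerPQ B /nbhs_LOP[s Qs sB]].
  apply: aut_eq => x.
  have [_ [[h _ <-] uQ]] := clQ _ (free_locally_constant Q u x).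
  rewrite -[LHS]/((val u) Q x) -uQ -{1}(mulgK h x) free_conj.
  by rewrite -[(val u) P _]/(proj P u _) uP /= mulgK.
(* The empty intersection of subbasic sets is treated apart, as [meet_embed]
   needs a head. *)
suff [h hs] : exists h, {in s, forall g, cone (conj_LO h P) g}.
  by exists (conj_LO h P); split; [exists h|exact: sB].
case: s Qs {sB} => [|g s] Qs; first by exists 1.
have Fu : free_lset G (meet_embed g s `|` 1)%O.
  have cF := @free_lset_closed G.
  by apply: (lgroup_closedU cF (free_lset_meet_embed g s) (lgroup_closed1 cF)).
pose u : freeL G := SigSub (mem_set Fu).
apply: contrapT => noh.
have /kerPQ uQ : ker_proj P u.
  apply: aut_eq => x; apply/join1_fixE/negP => /meet_embed_gt hs.
  by apply: noh; exists x.
have /join1_fixE/negP : (meet_embed g s `|` 1)%O Q 1 = 1.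
  by rewrite -[LHS]/(proj Q u 1) uQ.
apply; apply/meet_embed_gt => k ks; rewrite conj_LOP invg1 mul1g mulg1.
exact: Qs.
Qed.
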